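(* Let $p$ be a prime. Then there exists a word of length at least $p^2 - p - 1$ over the alphabet $\{0,1,\ldots,p-1\}$ that contains no congruential $2$-power modulo $p$ as a factor.
   Context: For an integer $k \ge 2$ and $r \ge 2$, a congruential $r$-power modulo $k$ is a word $x_1 x_2 \cdots x_r$ over the integers with $x_1,\ldots,x_r$ nonempty, $|x_1| = |x_2| = \cdots = |x_r|$, and $\sum x_1 \equiv \sum x_2 \equiv \cdots \equiv \sum x_r \pmod{k}$, where $\sum x$ is the sum of the entries of $x$. *)

(* Defs.v *)
From mathcomp Require Import all_boot all_order all_algebra.

Set Implicit Arguments.
Unset Strict Implicit.
Unset Printing Implicit Defensive.

Definition word_sum (x : seq int) : int := (\sum_(a <- x) a)%R.

Definition congruential_power (k r : nat) (w : seq int) : Prop :=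
  exists xs : seq (seq int),
    [/\ size xs = r,
        w = flatten xs,
        {in xs, forall x, x <> [::]},
        {in xs &, forall x y, size x = size y} &
        {in xs &, forall x y, (word_sum x = word_sum y %[mod k%:Z])%Z}].

Definition over_alphabet (k : nat) (w : seq int) : Prop :=
  {in w, forall a : int, (0 <= a < k%:Z)%R}.

(* Main.v *)
(** A word avoids congruential squares modulo [p] exactly when its prefix sums
    [S] satisfy [S i - 2 S (i + m) + S (i + 2m) <> 0] in [F_p] for all [m > 0].
    For odd [p] and a primitive root [g], take [S i = 2 g^(2i) - g i^2], whose
    second difference is [2 (g^(2i) (1 - g^(2m))^2 - g m^2)].  If it vanishes and
    [p] does not divide [m], then [g] is a square, which is impossible.  If [p]
    divides [m], then [g^(2m) = 1], so [p (p - 1)] divides [2m], which exceeds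
    the length of the word. *)
Require Import Defs.
From mathcomp Require Import all_boot all_order all_algebra.
From mathcomp Require Import cyclic finfield ring zify.

Set Implicit Arguments.
Unset Strict Implicit.
Unset Printing Implicit Defensive.

Import GRing.Theory.
Local Open Scope ring_scope.

Lemma Fp_expf_pred (p : nat) (p_prime : prime p) (x : 'F_p) :
  x != 0 -> x ^+ p.-1 = 1.
Proof.
move=> x_neq0; apply: (mulfI x_neq0); rewrite -exprS prednK ?prime_gt0 // mulr1.
by have := expf_card x; rewrite card_Fp.
Qed.

(** The [p.-1] nonzero residues are distinct roots of [X ^ p.-1 - 1], as many as its degree, which
    forces one of them to be primitive. *)
Lemma Fp_primitive_root (p : nat) (p_prime : prime p) :
  exists g : 'F_p, p.-1.-primitive_root g.
Proof.
pose rs := enum [pred x : 'F_p | x != 0].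
have p1_gt0 : (0 < p.-1)%N by have := prime_gt1 p_prime; lia.
have sz_rs : (p.-1 <= size rs)%N.
  by rewrite -cardE cardC1 card_Fp.
have rs_roots : all p.-1.-unity_root rs.
  apply/allP => x; rewrite mem_enum inE => x_neq0.
  by rewrite unity_rootE Fp_expf_pred.
have /hasP[g _ g_prim] := has_prim_root p1_gt0 rs_roots (enum_uniq _) sz_rs.
by exists g.
Qed.

Lemma primitive_root_neq0 (F : fieldType) (n : nat) (g : F) :
  n.-primitive_root g -> g != 0.
Proof.
move=> g_prim; apply/eqP => g0; have /eqP := prim_expr_order g_prim.
by rewrite g0 expr0n eqn0Ngt (prim_order_gt0 g_prim) eq_sym oner_eq0.
Qed.

(** If [g = x ^+ 2] then [g ^+ n = x ^+ n.*2 = 1], too small an exponent for an element of order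
    [n.*2]. *)
Lemma primitive_root_nonsquare (F : fieldType) (n : nat) (g x : F) :
  (0 < n)%N -> n.*2.-primitive_root g -> x ^+ n.*2 = 1 -> g != x ^+ 2.
Proof.
move=> n_gt0 g_prim xn1; apply/eqP => gx.
have /eqP : g ^+ n = 1 by rewrite gx -exprM mul2n.
by rewrite -(prim_order_dvd g_prim) => /dvdn_leq; lia.
Qed.

Definition prefix_sum (p : nat) (g : 'F_p) (j : nat) : 'F_p :=
  2 * g ^+ j.*2 - g * j%:R ^+ 2.

Lemma second_difference_neq0 (p : nat) (p_prime : prime p) (g : 'F_p) (i m : nat) :
  (2 < p)%N -> p.-1.-primitive_root g -> (0 < m)%N -> (m.*2 < p * p.-1)%N ->
  prefix_sum g (i + m) - prefix_sum g i !=
    prefix_sum g (i + m + m) - prefix_sum g (i + m).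
Proof.
move=> p_gt2 g_prim m_gt0 m_lt; apply/eqP => S_eq.
have p_odd : odd p by case: (even_prime p_prime); lia.
have two_neq0 : (2 : 'F_p) != 0.
  rewrite -(dvdn_pcharf (pchar_Fp p_prime)).
  by apply/negP => /dvdn_leq; lia.
(* Half of the vanishing second difference, with [g ^+ i.*2] absorbed into the square. *)
have key : (g ^+ i * (1 - g ^+ m.*2)) ^+ 2 = g * m%:R ^+ 2.
  apply: (mulfI two_neq0); apply/eqP; rewrite -subr_eq0; apply/eqP.
  move/eqP: S_eq; rewrite -subr_eq0 => /eqP S_eq.
  rewrite -oppr0 -S_eq /prefix_sum !doubleD !exprD !natrD -!muln2 !exprM.
  ring.
have g_neq0 : g != 0 := primitive_root_neq0 g_prim.
have [m0|m_neq0] := eqVneq (m%:R : 'F_p) 0.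
  move/eqP: key; rewrite m0 expr0n /= mulr0 sqrf_eq0 mulf_eq0 expf_eq0.
  rewrite (negbTE g_neq0) andbF /= subr_eq0 eq_sym -(prim_order_dvd g_prim) => dvd1.
  have dvdp : (p %| m.*2)%N.
    by rewrite -mul2n dvdn_mull // (dvdn_pcharf (pchar_Fp p_prime)) m0.
  (* [p] and [p.-1] are coprime and both divide [m.*2]. *)
  have : (p * p.-1 %| m.*2)%N.
    by rewrite Gauss_dvd ?dvdp // coprimenP ?prime_gt0.
  by move/dvdn_leq; lia.
have p1E : p.-1 = p.-1./2.*2 by lia.
(* Dividing [key] by the square of [m] exhibits a square root of [g]. *)
pose x := g ^+ i * (1 - g ^+ m.*2) / m%:R.
have gx : g = x ^+ 2 by rewrite exprMn key exprVn mulfK ?expf_neq0.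
have x_neq0 : x != 0 by apply/eqP => x0; rewrite gx x0 expr0n eqxx in g_neq0.
have := @primitive_root_nonsquare _ p.-1./2 g x.
rewrite -p1E -gx eqxx => nonsquare; suff: false by [].
by apply: nonsquare; rewrite ?Fp_expf_pred //; lia.
Qed.

Definition difference_word (p : nat) (S : nat -> 'F_p) (n : nat) : seq int :=
  mkseq (fun i => Posz (nat_of_ord (S i.+1 - S i))) n.

(** Cast back to ['F_p], each letter is again a step of [S], so the sum over a factor telescopes. *)
Lemma sum_difference_word (p : nat) (S : nat -> 'F_p) (n : nat)
    (u x v : seq int) :
  difference_word S n = u ++ x ++ v ->
  (word_sum x)%:~R = S (size u + size x)%N - S (size u).
Proof.
move=> wE.
have sz : n = (size u + (size x + size v))%N.
  by have := congr1 size wE; rewrite size_mkseq !size_cat.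
have -> : x = [seq Posz (nat_of_ord (S i.+1 - S i)) | i <- iota (size u) (size x)].
  have <- : take (size x) (drop (size u) (difference_word S n)) = x.
    by rewrite wE drop_size_cat // take_size_cat.
  rewrite -map_drop -map_take drop_iota take_iota.
  by congr map; rewrite !size_map size_iota; congr iota; lia.
rewrite size_map size_iota /word_sum big_map rmorph_sum.
rewrite (eq_bigr (fun i => S i.+1 - S i)) => [|i _]; last exact: natr_Zp.
have -> : iota (size u) (size x) = index_iota (size u) (size u + size x).
  by rewrite /index_iota addKn.
by rewrite telescope_sumr // leq_addr.
Qed.

Lemma Fp_intr_eq (p : nat) (p_prime : prime p) (a b : int) :
  (a = b %[mod p%:Z])%Z -> a%:~R = b%:~R :> 'F_p.
Proof.
move/eqP; rewrite eqz_mod_dvd => /dvdzP[q abE].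
apply/eqP; rewrite -subr_eq0 -rmorphB /= abE rmorphM /=.
by rewrite -pmulrn pchar_Fp_0 // mulr0.
Qed.

Lemma congruential_square_split (k : nat) (f : seq int) :
  congruential_power k 2 f ->
  exists x y, [/\ f = x ++ y, (0 < size x)%N, size y = size x &
                  (word_sum x = word_sum y %[mod k%:Z])%Z].
Proof.
case=> -[|x [|y [|? ?]]] [] // _ -> ne sz sm; exists x, y.
have xI : x \in [:: x; y] by rewrite !inE eqxx.
have yI : y \in [:: x; y] by rewrite !inE eqxx orbT.
split; [by rewrite /= cats0 | | exact: sz | exact: sm].
by rewrite lt0n size_eq0; apply/eqP/ne.
Qed.

Local Close Scope ring_scope.

Theorem theorem8 (p : nat) (p_prime : prime p) :
  exists w : seq int,
    [/\ p ^ 2 - p - 1 <= size w,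
        over_alphabet p w &
        forall f : seq int, infix f w -> ~ congruential_power p 2 f].
Proof.
(* For [p = 2] the required length is 1, and a single letter is too short to contain a square. *)
have [p_gt2|p_le2] := ltnP 2 p; last first.
  have -> : p = 2 by have := prime_gt1 p_prime; lia.
  exists [:: 0%R]; split => // [a|f /size_infix /= f_le1].
    by rewrite inE => /eqP ->.
  move=> /congruential_square_split [x [y [fE x_gt0 yE _]]].
  by move: f_le1; rewrite fE size_cat yE; lia.
have [g g_prim] := Fp_primitive_root p_prime.
pose S := prefix_sum g.
exists (difference_word S (p ^ 2 - p - 1)); split; first by rewrite size_mkseq.
  move=> a /mapP[i _ ->]; rewrite le0z_nat ltz_nat andTb.
  (* The ordinal bound built into ['F_p] equals [p] by primality. *)
  by rewrite -[ltnRHS](Fp_cast p_prime) ltn_ord.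
move=> f /infixP[u [v wE]].
move=> /congruential_square_split [x [y [fE x_gt0 yE /(Fp_intr_eq p_prime)]]].
rewrite fE -catA in wE.
rewrite (sum_difference_word wE).
(* Regrouped so that [y] is the middle factor, starting where [x] ends. *)
have wE' : difference_word S (p ^ 2 - p - 1) = (u ++ x) ++ y ++ v.
  by rewrite wE !catA.
rewrite (sum_difference_word wE') size_cat yE.
apply/eqP/second_difference_neq0 => //.
have ppE : p * p.-1 = p ^ 2 - p by rewrite -subn1 mulnBr muln1 mulnn.
(* Positivity keeps the truncated [p ^ 2 - p - 1] strictly below [p * p.-1]; the square, of length
   [(size x).*2], fits inside the word. *)
have pp_gt0 : 0 < p * p.-1 by rewrite muln_gt0; lia.
have := congr1 (@size int) wE; rewrite size_mkseq !size_cat yE ppE.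
by move: pp_gt0; rewrite ppE; lia.
Qed.
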